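(* For any integers $r,k\geq 1$, \[ \zeta(\underbrace{1, \ldots , 1}_{r-1}, k+1) =\sum^{\min(r,k)}_{j=1}(-1)^{j-1}\sum_{\substack{\mathrm{wt}(\mathbf{a})=k,\,\mathrm{wt}(\mathbf{b})=r\\ \mathrm{dep}(\mathbf{a})=\mathrm{dep}(\mathbf{b})=j}} \zeta(\mathbf{a}+\mathbf{b}), \] where the inner sum runs over all pairs of indices $\mathbf{a}=(a_1,\ldots,a_j)$, $\mathbf{b}=(b_1,\ldots,b_j)$ of positive integers with $a_1+\cdots+a_j=k$ and $b_1+\cdots+b_j=r$, and $\zeta(\mathbf{a}+\mathbf{b})$ denotes $\zeta(a_1+b_1,\ldots,a_j+b_j)$.
   Context: For an index $\mathbf{k}=(k_1,\ldots,k_r)$ of positive integers with $k_r>1$, the multiple zeta value is $\zeta(k_1,\ldots,k_r)=\sum_{0<m_1<\cdots<m_r} m_1^{-k_1}\cdots m_r^{-k_r}$. The weight of an index is $\mathrm{wt}(\mathbf{k})=k_1+\cdots+k_r$ and its depth is $\mathrm{dep}(\mathbf{k})=r$. *)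

(* Defs.v *)
From HB Require Import structures.
From mathcomp Require Import all_boot all_order all_algebra.
From mathcomp Require Import all_classical all_reals all_analysis.

Set Implicit Arguments.
Unset Strict Implicit.
Unset Printing Implicit Defensive.

Import Order.TTheory GRing.Theory Num.Theory.

Local Open Scope classical_set_scope.
Local Open Scope ring_scope.

Definition wt (k : seq nat) : nat := sumn k.
Definition dep (k : seq nat) : nat := size k.

Definition is_index (k : seq nat) : bool := all (leq 1) k.

(* [path ltn 0 m] says 0 < m_1 < ... < m_r. *)
Definition mzv_dom (r : nat) : set (seq nat) :=
  [set m | size m = r /\ path ltn 0%N m].

Definition mzv_term (R : realType) (k m : seq nat) : R :=
  \prod_(i < dep k) (nth 0%N m i)%:R ^- nth 0%N k i.

(* The terms are nonnegative, so the series is the unordered sum [esum] in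
   [\bar R]; it is finite when the last entry of the index k is at least 2, and
   only then is [mzv] meaningful ([fine] sends +oo to 0). *)
Definition mzv (R : realType) (k : seq nat) : R :=
  fine (\esum_(m in mzv_dom (dep k)) (mzv_term R k m)%:E).

Definition index_add (a b : seq nat) : seq nat :=
  [seq p.1 + p.2 | p <- zip a b]%N.

(* Entries of an index of weight w are at most w, so the indices of weight w and
   depth j are among the finitely many j-tuples over 'I_w.+1. *)
Definition index_of (w j : nat) (t : j.-tuple 'I_w.+1) : seq nat :=
  [seq val i | i <- t].
Definition index_wt (w j : nat) (t : j.-tuple 'I_w.+1) : bool :=
  is_index (index_of t) && (wt (index_of t) == w).

(* Main.v *)
(** Let zeta_{>n} denote the multiple zeta value with all summation variables
    larger than n.  For k, r >= 1 let h_n(k,r) be minus the coefficient of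
    x^k y^r in 2F1(y,-x;n+1-x;1).  Expanding the hypergeometric series at n = 0
    gives h_0(k,r) = zeta(1,...,1,k+1).  The contiguous relation behind Gauss's
    summation theorem, proved by a Wilf-Zeilberger certificate, reads
      h_{n-1}(k,r) - h_n(k,r) =
        sum_{a,b >= 1} n^{-a-b} (delta - h_n)(k-a,r-b),
    where delta is 1 at (0,0) and 0 elsewhere.  As h_n tends to 0, this
    telescopes to
      h_n(k,r) = sum_{m > n} sum_{a,b >= 1} m^{-a-b} (delta - h_m)(k-a,r-b),
    which iterates, ending after min(k,r) steps, to the alternating sum of the
    zeta_{>n}(a+b). *)

Require Import Defs.
From HB Require Import structures.
From mathcomp Require Import all_boot all_order all_algebra.
From mathcomp Require Import all_classical all_reals all_analysis.
From mathcomp Require Import ring lra zify.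

Import Order.TTheory GRing.Theory Num.Theory numFieldNormedType.Exports.
Local Open Scope ring_scope.

(** * Coefficients in x and y of the hypergeometric terms *)

(* The coefficient of x^k in x (1-x)_{m-1} / (n+1-x)_m. *)
Fixpoint xcoef (R : realType) (n m : nat) : nat -> R :=
  match n with
  | 0 => fun k => if k is _.+1 then m%:R ^- k else 0
  | n'.+1 => fix step k :=
      if k is k'.+1 then
        (step k' + n%:R * xcoef R n' m k - xcoef R n' m k') / (n + m)%:R
      else 0
  end.

Lemma xcoef0 (R : realType) (n m : nat) : xcoef R n m 0 = 0.
Proof. by case: n. Qed.

(** Raising n multiplies x (1-x)_{m-1} / (n+1-x)_m by (n+1-x) / (n+1+m-x); the identity compares
    coefficients of x^(k+1) after clearing the denominator. *)
Lemma xcoefS (R : realType) (n m k : nat) :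
  (n.+1 + m)%:R * xcoef R n.+1 m k.+1 =
  xcoef R n.+1 m k + n.+1%:R * xcoef R n m k.+1 - xcoef R n m k.
Proof. by rewrite /= [LHS]mulrC divfK // pnatr_eq0. Qed.

Lemma xcoef_invX (R : realType) (m k : nat) : (0 < m)%N ->
  m%:R * xcoef R 0 m k.+1 = xcoef R 0 m k + (k == 0)%N%:R.
Proof.
move=> m0; have mN0 : m%:R != 0 :> R by rewrite pnatr_eq0 -lt0n.
case: k => [|k] /=; first by rewrite expr1 mulfV // add0r.
by rewrite addr0 [in LHS]exprS invfM mulrA mulfV // mul1r.
Qed.

Lemma xcoef1 (R : realType) (n k : nat) :
  n.+1%:R * xcoef R n 1 k.+1 = xcoef R n 1 k + (k == 0)%N%:R.
Proof.
elim: n k => [|n IH] k; first by rewrite xcoef_invX.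
by rewrite -addn1 xcoefS -addrA IH; ring.
Qed.

(** Raising m multiplies x (1-x)_{m-1} / (n+1-x)_m by (m-x) / (n+m+1-x). As [xcoef] is defined by
    recursion on n, this is carried from n to n+1 through [xcoefS]. *)
Lemma xcoef_shift (R : realType) (n m k : nat) : (0 < m)%N ->
  (n + m.+1)%:R * xcoef R n m.+1 k.+1 - xcoef R n m.+1 k =
  m%:R * xcoef R n m k.+1 - xcoef R n m k.
Proof.
move=> m0; elim: n k => [|n IH] k.
  by rewrite add0n !xcoef_invX //; ring.
have N0 : (n.+1 + m)%:R != 0 :> R by rewrite pnatr_eq0.
elim: k => [|k IHk].
  rewrite !xcoef0 xcoefS !xcoef0; apply: (mulfI N0).
  have := IH 0%N; rewrite !xcoef0; have := xcoefS R n m 0; rewrite !xcoef0.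
  (* Scaling the two relations by m and n+1 beforehand leaves a goal that is a linear combination of
     the hypotheses, within reach of [lra]. *)
  rewrite addnS addSn => /(congr1 ( *%R m%:R)) h1 /(congr1 ( *%R n.+1%:R)) h2.
  by lra.
rewrite xcoefS; apply: (mulfI N0).
have := IH k.+1; have := IH k; have := xcoefS R n m k; have := xcoefS R n m k.+1.
move: IHk; rewrite xcoefS.
rewrite addnS addSn => h1 /(congr1 ( *%R m%:R)) h2 h3 h4.
by move=> /(congr1 ( *%R n.+1%:R)) h5; lra.
Qed.

(* The elementary symmetric polynomial of degree r in 1/p for n < p < m. *)
Fixpoint harm (R : realType) (r n m : nat) : R :=
  if r is r'.+1 then \sum_(n.+1 <= p < m) p%:R^-1 * harm R r' p m else 1.

(** The definition peels off the smallest variable; peeling off the largest one instead gives the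
    recurrence in m. *)
Lemma harm_recr (R : realType) (r n m : nat) : (n < m)%N ->
  harm R r.+1 n m.+1 = harm R r.+1 n m + m%:R^-1 * harm R r n m.
Proof.
elim: r n => [|r IH] n nm; first by rewrite /= big_nat_recr // mulr1.
rewrite [LHS]/= big_nat_recr //= [X in _ * X]big_geq // mulr0 addr0.
rewrite mulr_sumr -big_split /=; apply: eq_big_nat => p /andP[_ pm].
by rewrite -/(harm R r.+1 p m.+1) IH // mulrDr /=; congr (_ + _); ring.
Qed.

Lemma harm_ge0 (R : realType) (r n m : nat) : 0 <= harm R r n m.
Proof.
elim: r n => [|r IH] n //=; apply: sumr_ge0 => p _.
by rewrite mulr_ge0 // invr_ge0.
Qed.

(* The coefficient of y^r in (y)_m / m!, for m > 0. *)
Definition ycoef (R : realType) (m r : nat) : R :=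
  if r is r'.+1 then m%:R^-1 * harm R r' 0 m else 0.

(** Coefficient form of (y)_{m+1} = (m+y) (y)_m. *)
Lemma ycoefS (R : realType) (m r : nat) : (0 < m)%N ->
  m.+1%:R * ycoef R m.+1 r.+1 = m%:R * ycoef R m r.+1 + ycoef R m r.
Proof.
move=> m0; rewrite /ycoef mulVKf ?pnatr_eq0 // mulVKf ?pnatr_eq0 -?lt0n //.
by case: r => [|r]; rewrite ?addr0 // harm_recr.
Qed.

Lemma ycoef1 (R : realType) (r : nat) : ycoef R 1 r.+1 = (r == 0)%N%:R.
Proof. by case: r => [|r] /=; rewrite invr1 ?big_geq // mul1r. Qed.

Lemma ycoef_ge0 (R : realType) (m r : nat) : 0 <= ycoef R m r.
Proof. by case: r => [|r] //=; rewrite mulr_ge0 ?invr_ge0 ?harm_ge0. Qed.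

(** * The telescoping certificate *)

(* The Wilf-Zeilberger certificate of the Gauss summation
   (n-x)(n-y) 2F1(y,-x;n-x;1) = n(n-x-y) 2F1(y,-x;n+1-x;1). *)
Definition gauss_cert (R : realType) (n k r m : nat) : R :=
  m%:R * ycoef R m r.+1 *
    ((n + m)%:R * xcoef R n m k.+1 - xcoef R n m k).

(** Let X_n and Y be the series with coefficients [xcoef R n m] and [ycoef R m], and N = n+1. The
    left side is the coefficient of x^(k+1) y^(r+1) in ((N-x)(N-y) X_n - N(N-x-y) X_{n+1}) Y. The
    three recurrences express everything through X_{n+1} and Y, and a polynomial identity
    remains. *)
Lemma gauss_cert_telescope (R : realType) (n k r m : nat) : (0 < m)%N ->
  (n.+1%:R * ycoef R m r.+1 - ycoef R m r) *
    (n.+1%:R * xcoef R n m k.+1 - xcoef R n m k)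
  - n.+1%:R * (ycoef R m r.+1 *
      (n.+1%:R * xcoef R n.+1 m k.+1 - xcoef R n.+1 m k)
    - ycoef R m r * xcoef R n.+1 m k.+1) =
  gauss_cert R n.+1 k r m - gauss_cert R n.+1 k r m.+1.
Proof.
move=> m0; rewrite /gauss_cert ycoefS // xcoef_shift //.
have -> : n.+1%:R * xcoef R n m k.+1 - xcoef R n m k =
   (n.+1 + m)%:R * xcoef R n.+1 m k.+1 - xcoef R n.+1 m k by rewrite xcoefS; ring.
by rewrite natrD; ring.
Qed.

Lemma gauss_cert1 (R : realType) (n k r : nat) :
  gauss_cert R n k r 1 = ((k == 0) && (r == 0))%N%:R.
Proof.
rewrite /gauss_cert ycoef1 addn1 xcoef1 mul1r addrAC subrr add0r -natrM.
by rewrite mulnb andbC.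
Qed.

(** * Bounds on the coefficients *)

Lemma xcoef_bound (R : realType) (n m k : nat) : (0 < m)%N ->
  `|xcoef R n m k| <= 2 ^+ k / (n + m)%:R.
Proof.
(* The induction on n produces the factor (n+2)/(n+m), which is at most 1 only for m >= 2; so m = 1
   is settled apart by [xcoef1]. *)
case: m => [//|[_|m _]].
  elim: k => [|k IH]; first by rewrite xcoef0 normr0 divr_ge0.
  have n0 : 0 < n.+1%:R :> R by rewrite ltr0n.
  rewrite addn1 ler_pdivlMr // -(ger0_norm (ltW n0)) -normrM mulrC xcoef1.
  rewrite (le_trans (ler_normD _ _)) // exprS mulr_natl mulr2n lerD //.
    apply: (le_trans IH); rewrite addn1 ler_pdivrMr // ler_peMr ?exprn_ge0 //.
    by rewrite ler1n.
  rewrite normr_nat (le_trans _ (exprn_ege1 _ _)) ?ler1n //.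
  by rewrite lern1; case: eqP.
elim: n k => [|n IH] k.
  case: k => [|k]; first by rewrite normr0 divr_ge0.
  rewrite /= ger0_norm ?invr_ge0 ?exprn_ge0 // add0n.
  rewrite exprSr invfM ler_wpM2r ?invr_ge0 //.
  rewrite (@le_trans _ _ 1) ?exprn_ege1 ?ler1n //.
  by rewrite invf_le1 ?exprn_ege1 ?exprn_gt0 ?ltr0n ?ler1n.
elim: k => [|k IHk]; first by rewrite xcoef0 normr0 divr_ge0.
have N0 : 0 < (n.+1 + m.+2)%:R :> R by rewrite ltr0n.
have n0 : 0 < (n + m.+2)%:R :> R by rewrite addnS ltr0n.
rewrite ler_pdivlMr // -{1}(ger0_norm (ltW N0)) -normrM mulrC xcoefS.
rewrite (le_trans (ler_normB _ _)) // (le_trans (lerD (ler_normD _ _) (lexx _))) //.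
rewrite normrM normr_nat.
have IHk' : `|xcoef R n.+1 m.+2 k| <= 2 ^+ k / (n + m.+2)%:R.
  by rewrite (le_trans IHk) // ler_pM2l ?exprn_gt0 // lef_pV2 ?posrE // ler_nat.
rewrite (le_trans (lerD (lerD IHk' (ler_wpM2l _ (IH k.+1))) (IH k))) //.
rewrite [leLHS](_ : _ = 2 ^+ k.+1 * (n.+2%:R / (n + m.+2)%:R)); last first.
  by rewrite exprS -(natr1 n.+1); ring.
rewrite ler_piMr ?exprn_ge0 // ler_pdivrMr // mul1r ler_nat; lia.
Qed.

(* The value of (y)_m / m! at y = 1/2, whence [ycoef_bound] below. *)
Fixpoint cbin (R : realType) (m : nat) : R :=
  if m is m'.+1 then cbin R m' * (1 - (2 * m)%:R^-1) else 1.

Lemma cbinS (R : realType) (m : nat) :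
  m.+1%:R * cbin R m.+1 = (m%:R + 2^-1) * cbin R m.
Proof. by rewrite /= natrM -(natr1 m); field; rewrite natr1 pnatr_eq0. Qed.

Lemma cbin_ge0 (R : realType) (m : nat) : 0 <= cbin R m.
Proof.
elim: m => [|m IH] //=; rewrite mulr_ge0 // subr_ge0 invf_le1 ?ltr0n //.
by rewrite ler1n.
Qed.

Lemma cbin_le1 (R : realType) (m : nat) : cbin R m <= 1.
Proof.
elim: m => [|m IH] //=; rewrite (le_trans _ IH) //.
by rewrite ler_piMr ?cbin_ge0 // gerBl invr_ge0.
Qed.

Lemma cbin_sqr (R : realType) (m : nat) : m%:R * cbin R m ^+ 2 <= 1.
Proof.
(* Unlike m c_m^2, the product (2m+1) c_m^2 is nonincreasing: each step multiplies it by 1 -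
   1/(4(m+1)^2). *)
suff : (2 * m%:R + 1) * cbin R m ^+ 2 <= 1.
  apply: le_trans; rewrite ler_wpM2r ?sqr_ge0 //.
  by have : 0 <= m%:R :> R by []; lra.
elim: m => [|m IH]; first by rewrite mulr0 add0r mul1r expr1n.
apply: (le_trans _ IH) => /=; rewrite exprMn mulrCA mulrC.
rewrite ler_wpM2r ?sqr_ge0 // natrM -(natr1 m).
have m0 : 0 < m%:R + 1 :> R by rewrite natr1 ltr0n.
have -> : (2 * (m%:R + 1) + 1) * (1 - (2 * (m%:R + 1))^-1) ^+ 2 =
  (2 * m%:R + 1) * (1 - (4 * (m%:R + 1) ^+ 2)^-1) :> R.
  by field; rewrite lt0r_neq0.
by rewrite ler_piMr // ?gerBl ?invr_ge0 ?mulr_ge0 ?sqr_ge0 //.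
Qed.

Lemma cvg_cbin (R : realType) : (cbin R m @[m --> \oo] --> (0 : R))%classic.
Proof.
apply/cvgr0Pnorm_le => e e0; exists (Num.bound (e ^- 2)) => // m /= hm.
have em : e ^- 2 < m%:R.
  rewrite (lt_le_trans (archi_boundP _)) ?ler_nat // invr_ge0 sqr_ge0 //.
rewrite ger0_norm ?cbin_ge0 // -(@ler_pXn2r _ 2) ?nnegrE ?cbin_ge0 ?(ltW e0) //.
have m0 : 0 < m%:R :> R by rewrite (lt_trans _ em) // invr_gt0 exprn_gt0.
rewrite -(ler_pM2l m0) (le_trans (cbin_sqr R m)) //.
by rewrite -ler_pdivrMr ?exprn_gt0 // mul1r ltW.
Qed.

(** The coefficients of (y)_m / m! are nonnegative, so each, times 2^-r, is at most the value at y =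
    1/2. The induction plays [ycoefS] against [cbinS]. *)
Lemma ycoef_bound (R : realType) (m r : nat) :
  ycoef R m.+1 r <= 2 ^+ r * cbin R m.+1.
Proof.
elim: m r => [|m IH] [|r]; try by rewrite mulr_ge0 ?exprn_ge0 ?cbin_ge0.
  rewrite ycoef1 /= exprSr mul1r muln1 -mulrA.
  rewrite (_ : 2 * (1 - 2^-1) = 1 :> R) ?mulr1; last by field.
  by rewrite (le_trans _ (exprn_ege1 _ _)) ?ler1n // lern1; case: eqP.
rewrite -(ler_pM2l (ltr0Sn R m.+1)) ycoefS // [leRHS]mulrCA cbinS.
rewrite (le_trans (lerD (ler_wpM2l _ (IH r.+1)) (IH r))) //.
by rewrite [in leLHS]exprS [in leRHS]exprS le_eqVlt; apply/orP; left; apply/eqP; field.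
Qed.

Lemma cbin_telescope (R : realType) (m : nat) :
  cbin R m.+1 / m.+1%:R <= 2 * (cbin R m - cbin R m.+1).
Proof.
have -> : 2 * (cbin R m - cbin R m.+1) = cbin R m / m.+1%:R.
  by rewrite /= natrM; field.
by rewrite ler_wpM2r ?invr_ge0 //= ler_piMr ?cbin_ge0 // gerBl invr_ge0.
Qed.

(* The first M terms are at most 1/(n+1) each, and the others telescope. *)
Lemma sum_cbin_bound (R : realType) (n M K : nat) :
  \sum_(0 <= i < K) cbin R i.+1 / (n + i.+1)%:R <=
  M%:R / n.+1%:R + 2 * cbin R M.
Proof.
have headb L : \sum_(0 <= i < L) cbin R i.+1 / (n + i.+1)%:R <= L%:R / n.+1%:R.
  elim: L => [|L IH]; first by rewrite big_nil mul0r.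
  rewrite big_nat_recr //= -natr1 mulrDl lerD // -[leRHS]/(1 / _).
  rewrite ler_pM ?invr_ge0 // ?(cbin_ge0 R L.+1) ?(cbin_le1 R L.+1) //.
  by rewrite lef_pV2 ?posrE ?ltr0n ?ler_nat //; lia.
have [KM|/ltnW MK] := leqP K M.
  rewrite (le_trans (headb K)) // -[leLHS]addr0 lerD ?mulr_ge0 ?cbin_ge0 //.
  by rewrite ler_wpM2r ?invr_ge0 // ler_nat.
suff : \sum_(0 <= i < K) cbin R i.+1 / (n + i.+1)%:R <=
  M%:R / n.+1%:R + 2 * (cbin R M - cbin R K).
  by move/le_trans; apply; rewrite lerD2l ler_pM2l // gerBl cbin_ge0.
rewrite -(subnK MK); elim: (K - M)%N => [|d IH].
  by rewrite add0n subrr mulr0 addr0.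
rewrite addSn big_nat_recr //.
apply: (le_trans (lerD IH (_ : _ <= 2 * (cbin R (d + M) - cbin R (d + M).+1)))).
  apply: le_trans (cbin_telescope R (d + M)).
  apply: ler_wpM2l; first exact: cbin_ge0.
  by rewrite lef_pV2 ?posrE ?ltr0n ?ler_nat //; lia.
by rewrite -addrA -mulrDr subrKA.
Qed.

(** * Convergence of the series h_n and decay in n *)

Definition gterm (R : realType) (n k r i : nat) : R :=
  ycoef R i.+1 r * xcoef R n i.+1 k.

(* The h_n(k,r) of the header, extended by 0 to k = 0 and to r = 0. *)
Definition gsum (R : realType) (n k r : nat) : R :=
  limn (series (gterm R n k r)).

Lemma sum_gterm_bound (R : realType) (n k r M K : nat) :
  \sum_(0 <= i < K) `|gterm R n k r i| <=
  2 ^+ (r + k) * (M%:R / n.+1%:R + 2 * cbin R M).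
Proof.
apply: (@le_trans _ _
  (2 ^+ (r + k) * \sum_(0 <= i < K) cbin R i.+1 / (n + i.+1)%:R)).
  rewrite mulr_sumr ler_sum // => i _; rewrite normrM exprD mulrACA.
  by rewrite ler_pM ?xcoef_bound // ger0_norm ?ycoef_ge0 // ycoef_bound.
by rewrite ler_pM2l ?exprn_gt0 // sum_cbin_bound.
Qed.

Lemma is_cvg_gterm_norm (R : realType) (n k r : nat) :
  cvgn [normed series (gterm R n k r)].
Proof.
apply: nondecreasing_is_cvgn.
  by apply: nondecreasing_series => i _ _; exact: normr_ge0.
exists (2 ^+ (r + k) * (0%:R / n.+1%:R + 2 * cbin R 0)) => _ [K _ <-].
exact: sum_gterm_bound.
Qed.

Lemma cvg_gsum (R : realType) (n k r : nat) :
  (series (gterm R n k r) @ \oo --> gsum R n k r)%classic.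
Proof. exact: normed_cvg (is_cvg_gterm_norm R n k r). Qed.

Lemma gsum_bound (R : realType) (n k r M : nat) :
  `|gsum R n k r| <= 2 ^+ (r + k) * (M%:R / n.+1%:R + 2 * cbin R M).
Proof.
apply: (le_trans (lim_series_norm (is_cvg_gterm_norm R n k r))).
apply: limr_le; first exact: is_cvg_gterm_norm.
by apply: nearW => K; exact: sum_gterm_bound.
Qed.

Lemma cvg_gsum0 (R : realType) (k r : nat) :
  (gsum R n k r @[n --> \oo] --> (0 : R))%classic.
Proof.
apply/cvgr0Pnorm_le => e e0; set C : R := 2 ^+ (r + k).
have C0 : 0 < C by rewrite exprn_gt0.
(* The cut-off M is fixed first, so that 2 C [cbin R M] is at most e/2; then n is taken large enough
   for C M/(n+1) to be at most e/2. *)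
have /cvgr0Pnorm_le/(_ (e / (4 * C))) := @cvg_cbin R.
case=> [|M _ /(_ M (leqnn _)) /=]; first by rewrite divr_gt0 ?mulr_gt0.
rewrite ger0_norm ?cbin_ge0 // => bM.
exists (Num.bound (2 * C * M%:R / e)) => // n /= hn.
have en : 2 * C * M%:R / e <= n.+1%:R.
  apply: ltW; apply: lt_le_trans (archi_boundP _) _.
    by rewrite divr_ge0 ?mulr_ge0 // ltW.
  by rewrite ler_nat ltnW.
apply: (le_trans (gsum_bound R n k r M)); rewrite -/C mulrDr.
rewrite [leRHS](splitr e) lerD //.
  rewrite mulrA ler_pdivrMr ?ltr0n // mulrAC ler_pdivlMr // mulrC mulrA.
  by rewrite [leRHS]mulrC -ler_pdivrMr.
rewrite (_ : C * (2 * cbin R M) = cbin R M * (4 * C) / 2); last by field.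
by rewrite ler_pM2r ?invr_gt0 // -ler_pdivlMr ?mulr_gt0.
Qed.

(** * The contiguous relation for h_n *)

Lemma cvg_gauss_cert (R : realType) (n k r : nat) :
  (gauss_cert R n.+1 k r m.+1 @[m --> \oo] --> (0 : R))%classic.
Proof.
set C : R := 2 ^+ r.+1 * (n.+1%:R * 2 ^+ k.+1 + 2 ^+ k).
have Cb : (C * cbin R m.+1 @[m --> \oo] --> (0 : R))%classic.
  rewrite -[X in (_ --> X)%classic](mulr0 C); apply: cvgMr.
  by have := @cvg_cbin R; rewrite -(cvg_shiftS (cbin R)).
apply/cvgr0Pnorm_le => e e0; move/cvgr0Pnorm_le/(_ e e0): Cb.
apply: filterS => m; apply: le_trans; rewrite [leRHS]ger0_norm; last first.
  by rewrite mulr_ge0 ?cbin_ge0 // mulr_ge0 ?addr_ge0 ?mulr_ge0 ?exprn_ge0.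
(* The recurrence trades the growing factor n+1+m+1 for the constant n+1. The bound on [xcoef] then
   cancels the factor m+1 of the certificate, and only the decay of [cbin] is left. *)
rewrite /gauss_cert xcoefS [X in _ * X](_ : _ =
  n.+1%:R * xcoef R n m.+1 k.+1 - xcoef R n m.+1 k); last by ring.
rewrite 2!normrM normr_nat (ger0_norm (ycoef_ge0 _ _ _)) -mulrA mulrCA.
rewrite /C [leRHS]mulrAC; apply: ler_pM (ycoef_bound _ _ _) _ => //.
  exact: ycoef_ge0.
rewrite -ler_pdivlMl ?ltr0n // [leRHS]mulrC mulrDl.
have xb j : `|xcoef R n m.+1 j| <= 2 ^+ j / m.+1%:R.
  apply: (le_trans (xcoef_bound R n m.+1 j _)) => //.
  rewrite ler_wpM2l ?exprn_ge0 // lef_pV2 ?posrE ?ltr0n ?addnS //.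
  by rewrite ler_nat ltnS leq_addl.
rewrite (le_trans (ler_normB _ _)) // lerD // normrM normr_nat -mulrA.
by rewrite ler_wpM2l.
Qed.

(** With N = n+1 and H_n the generating function of [gsum R n], this is (N-x)(N-y)(H_n - H_{n+1}) =
    xy (1 - H_{n+1}). It is the summed certificate, because N(N-x-y) = (N-x)(N-y) - xy; the boundary
    term at m = 1 gives xy and the one at infinity vanishes. *)
Lemma gsum_rec (R : realType) (n k r : nat) :
  let D k r := gsum R n k r - gsum R n.+1 k r in
  n.+1%:R * (n.+1%:R * D k.+1 r.+1 - D k.+1 r) - (n.+1%:R * D k r.+1 - D k r) =
  ((k == 0) && (r == 0))%N%:R - gsum R n.+1 k r.
Proof.
move=> D; set N : R := n.+1%:R.
pose S a k r := series (gterm R a k r).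
pose T K := N * (N * S n k.+1 r.+1 K - S n k.+1 r K)
   - (N * S n k r.+1 K - S n k r K)
   - N * (N * S n.+1 k.+1 r.+1 K - S n.+1 k r.+1 K - S n.+1 k.+1 r K).
have TE K : T K = ((k == 0) && (r == 0))%N%:R - gauss_cert R n.+1 k r K.+1.
  rewrite -(gauss_cert1 R n.+1) /T /S; elim: K => [|K IH].
    by rewrite /series /= !big_geq //; ring.
  rewrite !seriesSr; have := gauss_cert_telescope R n k r K.+1 isT.
  by rewrite /gterm -/N; move: IH; set a := series _ _; lra.
have T1 : (T @ \oo --> N * (N * gsum R n k.+1 r.+1 - gsum R n k.+1 r)
   - (N * gsum R n k r.+1 - gsum R n k r)
   - N * (N * gsum R n.+1 k.+1 r.+1 - gsum R n.+1 k r.+1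
          - gsum R n.+1 k.+1 r))%classic.
  rewrite /T; repeat (first [exact: cvg_gsum | apply: cvgB | apply: cvgMr]).
have T2 : (T @ \oo --> (((k == 0) && (r == 0))%N%:R - 0 : R))%classic.
  rewrite (_ : T = fun K => ((k == 0) && (r == 0))%N%:R
     - gauss_cert R n.+1 k r K.+1); last exact/funext.
  by apply: cvgB; [exact: cvg_cst | exact: cvg_gauss_cert].
rewrite -[X in X - gsum R n.+1 k r]subr0 -(cvg_unique _ T1 T2) // /D; ring.
Qed.

(** * Tails of multiple zeta values as iterated sums *)

(* zeta_{>n}(k). *)
Fixpoint tzeta (R : realType) (k : seq nat) (n : nat) : \bar R :=
  if k is c :: s then
    (\sum_(m <oo | (n < m)%N) (m%:R ^- c)%:E * tzeta R s m)%E
  else 1%E.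

Lemma tzeta_ge0 (R : realType) (k : seq nat) (n : nat) : (0 <= tzeta R k n)%E.
Proof.
elim: k n => [|c s IH] n /=; first by rewrite lee01.
by apply: nneseries_ge0 => m _ _; rewrite mule_ge0 // lee_fin invr_ge0 exprn_ge0.
Qed.

Lemma mzv_term_ge0 (R : realType) (k m : seq nat) : 0 <= mzv_term R k m.
Proof. by apply: prodr_ge0 => i _; rewrite invr_ge0 exprn_ge0. Qed.

Lemma mzv_term_cons (R : realType) (c p : nat) (k m : seq nat) :
  mzv_term R (c :: k) (p :: m) = p%:R ^- c * mzv_term R k m.
Proof. by rewrite /mzv_term /= big_ord_recl. Qed.

(** The factor [x] is there for the induction: it absorbs the power of the smallest variable when
    the sum over the remaining ones is evaluated. *)
Lemma esum_tzeta (R : realType) (k : seq nat) (n : nat) (x : R) : 0 <= x ->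
  (\esum_(m in [set m | size m = size k /\ path ltn n m]%classic)
     (x * mzv_term R k m)%:E = x%:E * tzeta R k n)%E.
Proof.
elim: k n x => [|c s IH] n x x0 /=.
  rewrite [X in esum X _](_ : _ = [set [::]]%classic); last first.
    by apply/seteqP; split=> [[|a m] []|m ->].
  by rewrite esum_set1 /mzv_term /= big_ord0 mulr1 ?mule1 // lee_fin.
rewrite -nneseriesZl; last first.
  by move=> m _; rewrite mule_ge0 ?tzeta_ge0 // lee_fin invr_ge0 exprn_ge0.
rewrite nneseries_esum; last first.
  by move=> m _; rewrite !mule_ge0 ?tzeta_ge0 ?lee_fin // invr_ge0 exprn_ge0.
have pc p : 0 <= x * p%:R ^- c by rewrite mulr_ge0 // invr_ge0 exprn_ge0.
under [RHS]eq_esum => p _ do rewrite muleA -EFinM -IH //.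
rewrite esum_esum; last first.
  by move=> p m _ _; rewrite lee_fin mulr_ge0 ?mzv_term_ge0.
(* A nonempty increasing sequence is its head p > n together with an increasing tail above p. *)
rewrite (@reindex_esum _ _ _ ([set p | n < p]%N `*``
   (fun p => [set m | size m = size s /\ path ltn p m]))%classic _
   (fun pm => pm.1 :: pm.2)).
  by apply: eq_esum => -[p m] _ /=; rewrite mzv_term_cons mulrA.
split.
- by move=> [p m] [/= np [-> pm]]; rewrite np.
- by move=> [p m] [q l] _ _ /= [-> ->].
- move=> [|p m] [//= [sm] /andP[np pm]]; exists (p, m) => //=.
Qed.

Lemma sum_inv_sqr (R : realType) (M : nat) :
  \sum_(0 <= m < M) m%:R ^- 2 <= 2 :> R.
Proof.
case: M => [|[|M]]; first by rewrite big_geq.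
  by rewrite big_nat1 expr0n invr0.
(* The term m = 0 is 0 since 0 inverts to 0; the sharper bound is inductive because 1/m^2 <= 1/(m-1)
   - 1/m for m >= 2. *)
suff : \sum_(0 <= m < M.+2) m%:R ^- 2 <= 2 - M.+1%:R^-1 :> R.
  by move/le_trans; apply; rewrite gerBl invr_ge0.
elim: M => [|M IH].
  rewrite big_nat_recr // big_nat1 /= expr0n invr0 expr1n invr1; lra.
rewrite big_nat_recr // (le_trans (lerD IH (lexx _))) // -(natr1 M.+1).
set t : R := M.+1%:R; have t0 : 0 < t by rewrite ltr0n.
rewrite -subr_ge0.
have -> : 2 - (t + 1)^-1 - (2 - t^-1 + (t + 1) ^- 2) = t^-1 * (t + 1) ^- 2.
  by field; rewrite !lt0r_neq0 // addr_gt0.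
by rewrite mulr_ge0 ?invr_ge0 ?exprn_ge0 ?addr_ge0 ?ltW.
Qed.

(** Each entry contributes a factor at most the sum of m^-2, hence at most 2. All entries of a+b are
    at least 2, so every zeta value on the right of the theorem is finite. *)
Lemma tzeta_bound (R : realType) (k : seq nat) (n : nat) : all (leq 2) k ->
  (tzeta R k n <= (2 ^+ size k)%:E)%E.
Proof.
elim: k n => [|c s IH] n /=; first by rewrite expr0.
move=> /andP[c2 s2].
have t0 (m : nat) : (0 <= (m%:R ^- c)%:E * tzeta R s m)%E.
  by rewrite mule_ge0 ?tzeta_ge0 // lee_fin invr_ge0 exprn_ge0.
apply: lime_le; first by apply: is_cvg_nneseries => m _ _.
apply: nearW => M.
apply: (@le_trans _ _ (\sum_(0 <= m < M) (m%:R ^- 2 * 2 ^+ size s)%:E)%E).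
  rewrite big_mkcond /=; apply: lee_sum => m _; case: ltnP => [nm|_].
    rewrite EFinM lee_pmul ?lee_fin ?tzeta_ge0 ?IH ?invr_ge0 ?exprn_ge0 //.
    have m0 : 0 < m%:R :> R by rewrite ltr0n (leq_trans _ nm).
    rewrite lef_pV2 ?posrE ?exprn_gt0 // ler_weXn2l // ler1n.
    by rewrite (leq_trans _ nm).
  by rewrite lee_fin mulr_ge0 ?invr_ge0 ?exprn_ge0.
rewrite sumEFin lee_fin -mulr_suml exprS ler_wpM2r ?exprn_ge0 //.
exact: sum_inv_sqr.
Qed.

Definition rzeta (R : realType) (k : seq nat) (n : nat) : R := fine (tzeta R k n).

Lemma tzeta_fin_num (R : realType) (k : seq nat) (n : nat) :
  all (leq 2) k -> tzeta R k n \is a fin_num.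
Proof.
move=> k2; rewrite ge0_fin_numE ?tzeta_ge0 //.
exact: le_lt_trans (tzeta_bound R k n k2) (ltry _).
Qed.

Lemma cvg_rzeta (R : realType) (c : nat) (s : seq nat) (n : nat) :
  all (leq 2) (c :: s) ->
  (\sum_(0 <= m < M | (n < m)%N) m%:R ^- c * rzeta R s m @[M --> \oo] -->
   rzeta R (c :: s) n)%classic.
Proof.
move=> cs2; have /= /andP[c2 s2] := cs2.
have t0 (m : nat) : (0 <= (m%:R ^- c)%:E * tzeta R s m)%E.
  by rewrite mule_ge0 ?tzeta_ge0 // lee_fin invr_ge0 exprn_ge0.
have cv : cvgn (fun M => \sum_(0 <= m < M | (n < m)%N)
    (m%:R ^- c)%:E * tzeta R s m)%E by apply: is_cvg_nneseries.
have {}cv : ((\sum_(0 <= m < M | (n < m)%N)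
    (m%:R ^- c)%:E * tzeta R s m)%E @[M --> \oo] -->
    (rzeta R (c :: s) n)%:E)%classic.
  by rewrite /rzeta fineK ?tzeta_fin_num.
rewrite (_ : (fun _ => _) = fine \o (fun M => \sum_(0 <= m < M | (n < m)%N)
    (m%:R ^- c)%:E * tzeta R s m)%E); first exact: fine_cvg cv.
apply/funext => M /=.
rewrite [in RHS](eq_bigr (fun m => (m%:R ^- c * rzeta R s m)%:E)) ?sumEFin //.
by move=> m _; rewrite EFinM /rzeta fineK ?tzeta_fin_num.
Qed.

Lemma mzv_rzeta (R : realType) (k : seq nat) : mzv R k = rzeta R k 0.
Proof.
rewrite /mzv /rzeta -[tzeta R k 0]mul1e -esum_tzeta //; congr fine.
by apply: eq_esum => m _; rewrite mul1r.
Qed.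

(** * The value zeta(1,...,1,k+1) as h_0 *)

(** Terms are nonnegative, so the sums may be interchanged until the largest variable m is
    outermost; the smaller ones then collect into [harm]. *)
Lemma tzeta_height1 (R : realType) (r k n : nat) :
  tzeta R (rcons (nseq r 1%N) k.+1) n =
  (\sum_(m <oo | (n < m)%N) (m%:R ^- k.+1 * harm R r n m)%:E)%E.
Proof.
elim: r n => [|r IH] n /=.
  by apply: eq_eseriesr => m _; rewrite mulr1 mule1.
pose a (p m : nat) : \bar R :=
  (if (p < m)%N then (p%:R^-1 * (m%:R ^- k.+1 * harm R r p m))%:E else 0)%E.
have a0 p m : (0 <= a p m)%E.
  rewrite /a; case: ifP => // _; rewrite lee_fin.
  by rewrite !mulr_ge0 ?harm_ge0 ?invr_ge0 ?exprn_ge0.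
transitivity (\sum_(p <oo | (n < p)%N) \sum_(m <oo) a p m)%E.
  apply: eq_eseriesr => p _; rewrite IH expr1 -nneseriesZl; last first.
    by move=> m _; rewrite lee_fin mulr_ge0 ?harm_ge0 ?invr_ge0 ?exprn_ge0.
  by rewrite eseries_mkcond; apply: eq_eseriesr => m _; rewrite /a EFinM.
rewrite nneseries_interchange // [RHS]eseries_mkcond.
apply: eq_eseriesr => m _.
rewrite (nneseries_split_cond 0 m) // add0n.
rewrite [X in (_ + X)%E]eseries0 ?adde0; last first.
  by move=> p mp _; rewrite /a ltnNge mp.
have -> : (\sum_(0 <= p < m | (n < p)%N) a p m =
    \sum_(n.+1 <= p < m) (p%:R^-1 * (m%:R ^- k.+1 * harm R r p m))%:E)%E.
  rewrite [RHS](big_nat_widenl n.+1 0) // [LHS]big_nat_cond [RHS]big_nat_cond.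
  by apply: eq_bigr => p /andP[/andP[_ pm] _]; rewrite /a pm.
rewrite sumEFin.
case: ltnP => [nm|mn]; last by rewrite big_geq // leqW.
by rewrite mulr_sumr; congr EFin; apply: eq_bigr => p _; rewrite mulrCA.
Qed.

(** Entries equal to 1 put this value outside [tzeta_bound]; its finiteness comes from the
    convergence of the series defining [gsum]. *)
Lemma mzv_height1 (R : realType) (r k : nat) :
  mzv R (rcons (nseq r 1%N) k.+2) = gsum R 0 k.+1 r.+1.
Proof.
rewrite mzv_rzeta /rzeta tzeta_height1.
suff -> : (\sum_(m <oo | (0 < m)%N) (m%:R ^- k.+2 * harm R r 0 m)%:E)%E =
  (gsum R 0 k.+1 r.+1)%:E by [].
have g0 (i : nat) : (0 <= (i%:R ^- k.+2 * harm R r 0 i)%:E)%E.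
  by rewrite lee_fin mulr_ge0 ?harm_ge0 // invr_ge0 exprn_ge0.
rewrite -ereal_series -nneseries_addn //.
rewrite /gsum -EFin_lim; last exact: cvg_gsum.
apply: congr_lim; apply/funext => M /=.
rewrite sumEFin; congr EFin; apply: eq_bigr => i _.
by rewrite addn1 /gterm /= [in LHS]exprS invfM mulrAC.
Qed.

(** * Solving the contiguous relation for h_n - h_{n+1} *)

Lemma gsum0l (R : realType) (n r : nat) : gsum R n 0 r = 0.
Proof.
rewrite /gsum (_ : gterm R n 0 r = fun=> 0).
  by rewrite /series /=; under eq_fun do rewrite big1 //; exact: lim_cst.
by apply/funext => i; rewrite /gterm xcoef0 mulr0.
Qed.

Lemma gsum0r (R : realType) (n k : nat) : gsum R n k 0 = 0.
Proof.
rewrite /gsum (_ : gterm R n k 0 = fun=> 0).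
  by rewrite /series /=; under eq_fun do rewrite big1 //; exact: lim_cst.
by apply/funext => i; rewrite /gterm mul0r.
Qed.

(** On generating functions (c-x) f = x g, and x/(c-x) is the sum of c^-a x^a over a >= 1, with a =
    k-i here. *)
Lemma first_order_rec (F : fieldType) (c : F) (f g : nat -> F) (k : nat) :
  c != 0 -> f 0%N = 0 -> (forall i, c * f i.+1 - f i = g i) ->
  f k = \sum_(0 <= i < k) c ^- (k - i) * g i.
Proof.
move=> c0 f0 fS; elim: k => [|k IH]; first by rewrite big_geq.
rewrite big_nat_recr //= subSnn expr1.
have -> : \sum_(0 <= i < k) c ^- (k.+1 - i) * g i = c^-1 * f k.
  rewrite IH mulr_sumr; apply: eq_big_nat => i /andP[_ ik].
  by rewrite subSn 1?ltnW // exprS invfM mulrA.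
by rewrite -mulrDr -fS subrKC mulKf.
Qed.

(** The factors n+1-y and n+1-x of [gsum_rec] are inverted in turn; k-i and r-l are the exponents a,
    b >= 1. *)
Lemma gsum_diff (R : realType) (n k r : nat) :
  gsum R n k r - gsum R n.+1 k r =
  \sum_(0 <= i < k) \sum_(0 <= l < r) n.+1%:R ^- (k - i + (r - l)) *
    (((i == 0) && (l == 0))%N%:R - gsum R n.+1 i l).
Proof.
pose D k r := gsum R n k r - gsum R n.+1 k r.
have N0 : n.+1%:R != 0 :> R by rewrite pnatr_eq0.
rewrite -/(D k r) (@first_order_rec _ n.+1%:R (D k)
  (fun l => n.+1%:R * D k l.+1 - D k l)) //; last first.
  by rewrite /D !gsum0r subrr.
rewrite [RHS]exchange_big /=; apply: eq_bigr => l _.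
rewrite (@first_order_rec _ n.+1%:R (fun k => n.+1%:R * D k l.+1 - D k l)
  (fun i => ((i == 0) && (l == 0))%N%:R - gsum R n.+1 i l) k N0) /=.
- by rewrite mulr_sumr; apply: eq_bigr => i _; rewrite exprD invfM; ring.
- by rewrite /D !gsum0l; ring.
- by move=> i; rewrite -gsum_rec.
Qed.

(** * Enumeration of indices by depth and weight *)

(* The indices of depth j and weight k, with i the weight of the tail. *)
Fixpoint comps (j k : nat) : seq (seq nat) :=
  if j is j'.+1 then
    [seq (k - i)%N :: s | i <- index_iota 0 k, s <- comps j' i]
  else if k == 0%N then [:: [::]] else [::].

Lemma mem_comps (j k : nat) (s : seq nat) :
  (s \in comps j k) = [&& size s == j, is_index s & wt s == k].
Proof.
elim: j k s => [|j IH] k s.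
  by case: s => [|a s]; case: k => [|k].
apply/allpairsPdep/idP => [[i [t [/=]]]|].
  rewrite mem_index_iota IH => ik /and3P[/eqP sj ti /eqP ti'] ->.
  by rewrite /is_index /wt /= -/(is_index t) ti sj -/(wt t) ti'; lia.
case: s => [|a s] // /and3P[/= sj /andP[a0 si] /eqP sk].
rewrite eqSS in sj; exists (wt s), s; rewrite mem_index_iota IH si sj eqxx /=.
by move: sk; rewrite /wt /=; split=> //; first lia; congr (_ :: _); lia.
Qed.

Lemma comps_uniq (j k : nat) : uniq (comps j k).
Proof.
elim: j k => [|j IH] k /=; first by case: eqP.
apply: allpairs_uniq_dep; rewrite ?iota_uniq //.
move=> /= [i s] [l t] /allpairsPdep[i' [s' [+ _ ->]]] /allpairsPdep[l' [t' [+ _ ->]]] /=.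
rewrite !mem_index_iota => /= ik lk [il ->].
by have -> : i' = l' by lia.
Qed.

Lemma sum_index_wt (V : nmodType) (j k : nat) (f : seq nat -> V) :
  \sum_(a : j.-tuple 'I_k.+1 | index_wt a) f (index_of a) =
  \sum_(s <- comps j k) f s.
Proof.
rewrite -big_filter -(big_map (@index_of k j) predT f).
apply: perm_big; apply: uniq_perm; rewrite ?comps_uniq //.
  rewrite map_inj_uniq ?filter_uniq ?index_enum_uniq // => a b ab.
  by apply/val_inj/(inj_map val_inj).
move=> s; rewrite mem_comps; apply/mapP/idP => [[a + ->]|/and3P[sj si sk]].
  rewrite mem_filter => /andP[/andP[-> ->] _].
  by rewrite size_map size_tuple eqxx.
(* Every entry of s is at most its weight k, so [inord] loses nothing. *)
have sE : [seq val i | i <- [seq inord i : 'I_k.+1 | i <- s]] = s.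
  rewrite -map_comp -[RHS]map_id; apply/eq_in_map => i si' /=.
  rewrite inordK // ltnS -(eqP sk) /wt.
  elim: s si' {sj si sk} => //= a s IH; rewrite inE => /orP[/eqP->|/IH]; lia.
have tE : size [seq inord i : 'I_k.+1 | i <- s] == j by rewrite size_map.
exists (Tuple tE); last by rewrite /index_of sE.
by rewrite mem_filter mem_index_enum andbT /index_wt /index_of sE si sk.
Qed.

(** * Iteration of the telescoped recurrence *)

Definition pair_sum (R : realType) (j n k r : nat) : R :=
  \sum_(s <- comps j k) \sum_(t <- comps j r) rzeta R (index_add s t) n.

(** Identifies the delta term of [gsum_diff] with the depth 0 sum, so that it joins the alternating
    sum as its first term. *)
Lemma pair_sum0 (R : realType) (n k r : nat) :
  pair_sum R 0 n k r = ((k == 0) && (r == 0))%N%:R.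
Proof.
by rewrite /pair_sum /=; case: eqP; case: eqP => _ _; rewrite !(big_nil, big_seq1).
Qed.

Lemma cvg_sum_seq (R : realType) (T : eqType) (s : seq T)
    (f : T -> nat -> R) (l : T -> R) :
  {in s, forall x, (f x @ \oo --> l x)%classic} ->
  (\sum_(x <- s) f x M @[M --> \oo] --> \sum_(x <- s) l x)%classic.
Proof.
elim: s => [|a s IH] fl.
  by rewrite big_nil; under eq_fun do rewrite big_nil; exact: cvg_cst.
rewrite big_cons; under eq_fun do rewrite big_cons.
apply: cvgD; first by apply: fl; rewrite mem_head.
by apply: IH => x xs; apply: fl; rewrite inE xs orbT.
Qed.

Lemma index_add_ge2 (s t : seq nat) : is_index s -> is_index t ->
  all (leq 2) (index_add s t).
Proof.
elim: s t => [|a s IH] [|b t] //= /andP[a0 s0] /andP[b0 t0].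
by rewrite -/(index_add s t) IH // andbT; lia.
Qed.

(** The first entries of a and b are k-i and r-l, and m is the smallest summation variable. Only
    finite sums are interchanged before the limit is taken pair by pair. *)
Lemma cvg_pair_sum (R : realType) (j n k r : nat) :
  (\sum_(0 <= m < M | (n < m)%N) \sum_(0 <= i < k) \sum_(0 <= l < r)
     m%:R ^- (k - i + (r - l)) * pair_sum R j m i l @[M --> \oo] -->
   pair_sum R j.+1 n k r)%classic.
Proof.
rewrite /pair_sum [X in (_ --> X)%classic]/= big_allpairs_dep /=.
rewrite (_ : (fun M => _) = fun M => \sum_(0 <= i < k) \sum_(s <- comps j i)
    \sum_(0 <= l < r) \sum_(t <- comps j l) \sum_(0 <= m < M | (n < m)%N)
      m%:R ^- (k - i + (r - l)) * rzeta R (index_add s t) m); last first.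
  apply/funext => M; rewrite exchange_big /=; apply: eq_bigr => i _.
  rewrite exchange_big /= [RHS]exchange_big /=; apply: eq_bigr => l _.
  under eq_bigr do rewrite mulr_sumr.
  rewrite exchange_big /=; apply: eq_bigr => s _.
  under eq_bigr do rewrite mulr_sumr.
  by rewrite exchange_big.
apply: cvg_sum_seq => i; rewrite mem_index_iota => /= ik.
apply: cvg_sum_seq => s; rewrite mem_comps => /and3P[_ si _].
rewrite big_allpairs_dep /=.
apply: cvg_sum_seq => l; rewrite mem_index_iota => /= lr.
apply: cvg_sum_seq => t; rewrite mem_comps => /and3P[_ ti _].
by apply: cvg_rzeta; rewrite /= index_add_ge2 // andbT; lia.
Qed.

Lemma cvg_gsum_telescope (R : realType) (n k r : nat) :
  (\sum_(0 <= m < M | (n < m)%N) \sum_(0 <= i < k) \sum_(0 <= l < r)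
     m%:R ^- (k - i + (r - l)) *
     (((i == 0) && (l == 0))%N%:R - gsum R m i l) @[M --> \oo] -->
   gsum R n k r)%classic.
Proof.
have cv : (gsum R n k r - gsum R (d + n) k r @[d --> \oo] -->
    gsum R n k r)%classic.
  rewrite -[X in (_ --> X)%classic]subr0; apply: cvgB; first exact: cvg_cst.
  by have := @cvg_gsum0 R k r; rewrite -(cvg_shiftn n).
(* After this shift the partial sum of rank d runs over n < m <= n+d and equals h_n - h_{n+d}
   exactly. *)
rewrite -(cvg_shiftn n.+1) /=; apply: cvg_trans cv.
rewrite (_ : (fun M => _) = fun d => gsum R n k r - gsum R (d + n) k r) //.
apply/funext; elim=> [|d IH].
  rewrite subrr big_nat_cond big1 // => m; lia.
rewrite addSn big_mkcond big_nat_recr //= -big_mkcond /= IH.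
rewrite (_ : (n < d + n.+1)%N) ?addnS; last by lia.
by rewrite -gsum_diff addSn subrKA.
Qed.

(** A bound [J] in place of the exact minimum serves all the pairs i < k, l < r at once: their
    minimum drops by at least one, so one induction hypothesis applies. At [J = 0] either k or r is
    0 and both sides vanish. *)
Lemma gsum_pair_sum (R : realType) (J n k r : nat) : (minn k r <= J)%N ->
  gsum R n k r = \sum_(0 <= j < J) (-1) ^+ j * pair_sum R j.+1 n k r.
Proof.
elim: J n k r => [|J IH] n k r krJ.
  rewrite big_geq //; move: krJ; rewrite leqn0 minnE.
  by case: k => [|k]; [rewrite gsum0l|case: r => [|r]; [rewrite gsum0r|lia]].
apply: (cvg_unique _ (@cvg_gsum_telescope R n k r)) => //.
rewrite (_ : (fun M => _) = fun M => \sum_(0 <= j < J.+1) (-1) ^+ j *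
   \sum_(0 <= m < M | (n < m)%N) \sum_(0 <= i < k) \sum_(0 <= l < r)
     m%:R ^- (k - i + (r - l)) * pair_sum R j m i l).
  by apply: cvg_sum_seq => j _; apply: cvgMr; exact: cvg_pair_sum.
apply/funext => M; under [RHS]eq_bigr do rewrite mulr_sumr.
rewrite [RHS]exchange_big /=; apply: eq_bigr => m _.
under [RHS]eq_bigr do rewrite mulr_sumr.
rewrite [RHS]exchange_big /=; apply: eq_big_nat => i /= ik.
under [RHS]eq_bigr do rewrite mulr_sumr.
rewrite [RHS]exchange_big /=; apply: eq_big_nat => l /= lr.
(* Subtracting the expansion of h_m from the depth 0 term raises each depth by one and flips its
   sign. *)
rewrite -(pair_sum0 R m) (IH m i l); last by lia.
under [RHS]eq_bigr do rewrite mulrCA.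
rewrite -mulr_sumr; congr (_ * _).
rewrite [RHS]big_nat_recl // expr0 mul1r; congr (_ + _).
by rewrite -sumrN; apply: eq_bigr => j _; rewrite exprS mulN1r mulNr.
Qed.

Theorem theorem1 (R : realType) (r k : nat) (hr : (1 <= r)%N) (hk : (1 <= k)%N) :
  mzv R (rcons (nseq (r - 1) 1%N) (k + 1)%N) =
  \sum_(1 <= j < (minn r k).+1)
     (-1) ^+ (j - 1) *
     \sum_(a : j.-tuple 'I_k.+1 | index_wt a)
       \sum_(b : j.-tuple 'I_r.+1 | index_wt b)
         mzv R (index_add (index_of a) (index_of b)).
Proof.
case: r hr => [//|r] _; case: k hk => [//|k] _.
rewrite subSS subn0 addn1 mzv_height1 (@gsum_pair_sum _ (minn r.+1 k.+1)); last first.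
  by rewrite minnC.
rewrite big_add1 /=; apply: eq_bigr => j _; rewrite subSS subn0; congr (_ * _).
rewrite /pair_sum -sum_index_wt; apply: eq_bigr => a _.
by rewrite -sum_index_wt; apply: eq_bigr => b _; rewrite mzv_rzeta.
Qed.
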